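(* Let $X$ be a separable Fréchet space and $T$ a continuous linear operator on $X$. Assume that there exist a dense subset $X_0$ of $X$ and a mapping $S:X_0 \to X_0$ such that $T(S(x))=x$ for all $x\in X_0$. If $\Lambda$ is a countable relatively compact non-empty subset of $(a_T(X_0,S),b_T(X_0,S))$, then $\bigcap_{\lambda \in \Lambda}FHC(\lambda T)\neq \emptyset$.
   Context: $\mathbb{N}=\{0,1,2,\ldots\}$. Given $X_0$ dense in $X$ and a map $S:X_0\to X_0$ with $T(S(x))=x$ for $x\in X_0$, set $$a_T(X_0,S)=\inf\Big\{\lambda>0:\ \sum_{n\geq 0}\frac{S^n(x)}{\lambda^n}\text{ converges unconditionally for all }x\in X_0\Big\}=\inf\{\lambda>0:\ (\lambda^{-n}S^n(x))_{n\in\mathbb{N}}\text{ is bounded for all }x\in X_0\},$$ $$b_T(X_0,S)=\sup\Big\{\lambda>0:\ \sum_{n\geq 0}(\lambda T)^n(x)\text{ converges unconditionally for all }x\in X_0\Big\}=\sup\{\lambda>0:\ ((\lambda T)^n(x))_{n\in\mathbb{N}}\text{ is bounded for all }x\in X_0\}$$ ($b_T(X_0,S)$ may be $+\infty$; $(a,b)=\emptyset$ if $a\ge b$). $FHC(T)$ is the set of frequently hypercyclic vectors of $T$: those $x\in X$ such that for every non-empty open $U\subset X$, $\underline{d}(\{n\in\mathbb{N}:T^n(x)\in U\})>0$, where $\underline{d}(E)=\liminf_{n\to\infty}\frac{\mathrm{card}([0,n]\cap E)}{n+1}$. A subset of an open interval $I$ is relatively compact in $I$ if its closure is a compact subset of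 $I$. *)

(* Defs.v *)
From HB Require Import structures.
From mathcomp Require Import all_boot all_order all_algebra.
From mathcomp Require Import complex.
From mathcomp Require Import all_classical all_reals all_analysis.

Set Implicit Arguments.
Unset Strict Implicit.
Unset Printing Implicit Defensive.

Import Order.TTheory GRing.Theory Num.Theory.
Import numFieldNormedType.Exports.

Local Open Scope classical_set_scope.
Local Open Scope ring_scope.

(* A Fréchet space may be real or complex; [scalar_field R k] is R or R[i]. *)
Variant scalar_kind := RealScalars | ComplexScalars.

Definition scalar_field (R : realType) (k : scalar_kind) : numFieldType :=
  match k with RealScalars => R | ComplexScalars => R[i] end.

Definition real_scalar (R : realType) (k : scalar_kind) :
    R -> scalar_field R k :=
  match k with RealScalars => id | ComplexScalars => real_complex R end.

Definition separable (X : topologicalType) :=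
  exists2 D : set X, countable D & dense D.

(* The homogeneity equation p (a x) = |a| p x is written in the scalar field,
   where the norm `|a| lives; nonnegativity of p follows from the two
   clauses. *)
Definition seminorm (R : realType) (k : scalar_kind)
    (X : lmodType (scalar_field R k)) (p : X -> R) :=
  (forall x y, p (x + y) <= p x + p y) /\
  (forall (a : scalar_field R k) x,
     real_scalar k (p (a *: x)) = `|a| * real_scalar k (p x)).

Definition cauchy_sequence (K : numDomainType) (X : topologicalLmodType K)
    (u : nat -> X) :=
  forall U : set X, nbhs 0 U -> \forall m & n \near \oo, U (u m - u n).

(* The topology comes from a separating increasing sequence of seminorms, and
   the space is complete. Being first countable, it is complete as soon as
   its Cauchy sequences converge. The class [tvsType] is not used because its
   uniformity need not be the one given by translations. *)
Definition frechet_space (R : realType) (k : scalar_kind)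
    (X : topologicalLmodType (scalar_field R k)) :=
  (exists p : nat -> X -> R,
    [/\ forall n, seminorm (p n),
        forall n x, p n x <= p n.+1 x,
        forall x, (forall n, p n x = 0) -> x = 0
      & forall (x : X) (U : set X), nbhs x U <->
          exists n e, 0 < e /\ [set y | p n (y - x) < e] `<=` U]) /\
  (forall u : nat -> X, cauchy_sequence u -> exists l : X, u @ \oo --> l).

Definition unconditionally_convergent (K : numDomainType)
    (X : topologicalLmodType K) (u : nat -> X) :=
  forall s : nat -> nat, bijective s ->
    exists l : X, series (u \o s) @ \oo --> l.

Definition scale_op (R : realType) (k : scalar_kind)
    (X : lmodType (scalar_field R k)) (l : R) (T : X -> X) : X -> X :=
  fun x => real_scalar k l *: T x.

(* Over \bar R the infimum of the empty set is +oo and the supremum of the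
   empty set is -oo; in both cases the interval ]a_T, b_T[ is empty. *)
Definition a_T (R : realType) (k : scalar_kind)
    (X : topologicalLmodType (scalar_field R k)) (X0 : set X) (S : X -> X) :
    \bar R :=
  ereal_inf [set l%:E | l in [set l : R | 0 < l /\
    forall x, X0 x ->
      unconditionally_convergent
        (fun n => real_scalar k (l ^- n) *: iter n S x)]].

Definition b_T (R : realType) (k : scalar_kind)
    (X : topologicalLmodType (scalar_field R k)) (X0 : set X) (T : X -> X) :
    \bar R :=
  ereal_sup [set l%:E | l in [set l : R | 0 < l /\
    forall x, X0 x ->
      unconditionally_convergent (fun n => iter n (scale_op l T) x)]].

Definition lower_density (R : realType) (E : set nat) : \bar R :=
  limn_einf (fun n : nat =>
    ((\sum_(0 <= i < n.+1 | i \in E) 1)%N%:R / n.+1%:R : R)%:E).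

Definition FHC (R : realType) (X : topologicalType) (T : X -> X) : set X :=
  [set x | forall U : set X, open U -> U !=set0 ->
    (0 < lower_density R [set n | U (iter n T x)])%E].

Definition relatively_compact_in (X : topologicalType) (I L : set X) :=
  compact (closure L) /\ closure L `<=` I.

(* Main.v *)
Require Import Defs.
From HB Require Import structures.
From mathcomp Require Import all_boot all_order all_algebra.
From mathcomp Require Import complex.
From mathcomp Require Import all_classical all_reals all_analysis.
From mathcomp Require Import zify ring lra.

Set Implicit Arguments.
Unset Strict Implicit.
Unset Printing Implicit Defensive.

Import Order.TTheory GRing.Theory Num.Theory.
Import numFieldNormedType.Exports.

Local Open Scope classical_set_scope.
Local Open Scope ring_scope.

(** Compactness puts L inside some [al, be] with a_T < al <= be < b_T. So there
    are a < al and b > be such that, in each seminorm, S^n y = O(a^n) and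
    T^n y = O(b^-n) for all y in X0: this holds at one point of the domain of
    convergence of each series, because a convergent series has bounded terms
    ([growth_below_a_T], [growth_above_b_T]).

    Enumerate pairs (lam_p, y_p), lam_p in L and y_p in X0, in such a way that
    each member of L is paired infinitely often with points arbitrarily close
    to any given point of X. The common frequently hypercyclic vector is
      x = sum over p of the sum over n in E_p of lam_p^-n S^n y_p,
    for disjoint sets E_p of positive lower density. If m is in E_p, then
    (lam_p T)^m maps the term of index m to y_p, and the rest is an error. A
    term with n in E_p' contributes to it at most
      C (lam_p / lam_p')^(min m n) t^|m - n|,   t = max (a / al) (be / b) < 1
    ([interaction_le]). For p = p' the first factor is 1, and elements of E_p
    that are far apart suffice, as in the usual frequent hypercyclicity
    criterion. For p <> p' the first factor may grow exponentially in
    min m n, and only a gap |m - n| proportional to min m n can absorb it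
    ([gap_absorbs_ratio]). The ratios lam_p / lam_p' being bounded by be / al,
    one multiplicative gap H serves for all pairs: it is enough that
    max m n >= H (min m n) whenever m is in E_p and n in E_p' with p <> p'.

    Such sets exist: cut the integers into blocks [H^t, H^(t+1)[ and give to p
    the blocks whose index t has 2-adic valuation p + 1. The indices of blocks
    with different owners are distinct even numbers, so a whole block lies
    between them ([block_set_gap]); and p owns one block out of 2^(p+2)
    consecutive ones, which costs only a constant factor in the density
    ([block_set_count]). *)

(** * Sets of times separated by multiplicative gaps *)

(** [trunc_log H n] is the index of the block containing n. The valuation is
    p + 1, not p, so that the block index is even and positive: the odd blocks
    serve as gaps. *)
Definition block_set (H M p : nat) : set nat :=
  [set n | (M %| n)%N /\ logn 2 (trunc_log H n) = p.+1].

Lemma block_set_gt0 (H M p n : nat) : block_set H M p n -> (0 < n)%N.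
Proof. by case: n => // -[_]; rewrite trunc_log0 logn0. Qed.

Lemma block_set_ge (H M p n : nat) : block_set H M p n -> (M <= n)%N.
Proof. by move=> En; apply: dvdn_leq (block_set_gt0 En) En.1. Qed.

Lemma block_set_dist (H M p m n : nat) : block_set H M p m ->
  block_set H M p n -> m != n -> (M <= (m - n) + (n - m))%N.
Proof.
move=> [Mm _] [Mn _]; rewrite neq_ltn => /orP[] lt_mn; apply: dvdn_leq.
- by lia.
- by rewrite dvdn_add ?dvdn_sub.
- by lia.
- by rewrite dvdn_add ?dvdn_sub.
Qed.

(** The block indices of m and n are distinct even numbers, so they differ by
    at least 2. *)
Lemma block_set_gap (H M M' p p' m n : nat) : (1 < H)%N ->
  block_set H M p m -> block_set H M' p' n -> p != p' -> (m < n)%N ->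
  (H * m <= n)%N.
Proof.
move=> H1 Em En pp' mn.
have m0 := block_set_gt0 Em; have n0 := block_set_gt0 En.
have /andP[_ ltm] := trunc_log_bounds H1 m0.
have /andP[len _] := trunc_log_bounds H1 n0.
case: Em En => _ em [_ en].
have le_tt : (trunc_log H m <= trunc_log H n)%N by apply/leq_trunc_log/ltnW.
have even t i : logn 2 t = i.+1 -> exists j, t = j.*2.
  move=> e; exists (t./2); rewrite -[LHS]odd_double_half.
  have : (2 %| t)%N by apply: contraPT (isT) => nd; move: e; rewrite lognE (negbTE nd) !andbF.
  by rewrite dvdn2 => /negbTE ->.
have [j ej] := even _ _ em; have [j' ej'] := even _ _ en.
have jj' : (j < j')%N.
  have : trunc_log H m != trunc_log H n.
    by apply: contraNneq pp' => e; move: em; rewrite e en => -[->].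
  by move: le_tt; rewrite ej ej'; lia.
apply: leq_trans len; apply: (@leq_trans (H ^ (trunc_log H m).+2)).
  by rewrite (expnS H _.+1) leq_mul2l (ltnW ltm) orbT.
by rewrite leq_pexp2l ?(ltnW H1)// ej ej'; lia.
Qed.

Lemma card_le_count (E : set nat) (N : nat) (s : seq nat) : uniq s ->
  (forall i, i \in s -> (i < N)%N /\ E i) ->
  (size s <= \sum_(0 <= i < N | i \in E) 1)%N.
Proof.
move=> us sE; rewrite -big_filter sum1_size; apply: uniq_leq_size us _ => i si.
have [iN Ei] := sE i si.
by rewrite mem_filter mem_index_iota (mem_set Ei) iN.
Qed.

Lemma count_mono (E F : set nat) (N : nat) : E `<=` F ->
  (\sum_(0 <= i < N | i \in E) 1 <= \sum_(0 <= i < N | i \in F) 1)%N.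
Proof.
move=> EF; rewrite big_mkcond [leqRHS]big_mkcond; apply: leq_sum => i _.
by case: ifP => // /set_mem/EF/mem_set ->.
Qed.

(** Positive lower density, in multiplicative form. The block indices of p form
    an arithmetic progression of difference 2e, e = 2^(p+1); so below n there
    is a full block of p starting at H^t with n < H^(t + 2e + 1), and it
    contains about H^t / M multiples of M. *)
Lemma block_set_count (H M p : nat) : (2 < H)%N -> (0 < M)%N ->
  exists Q N0, (0 < Q)%N /\ forall n, (N0 <= n)%N ->
    (n.+1 <= Q * \sum_(0 <= i < n.+1 | i \in block_set H M p) 1)%N.
Proof.
move=> H2 M0; have H1 : (1 < H)%N by lia.
have H0 : (0 < H)%N by lia.
pose e := (2 ^ p.+1)%N; have e0 : (0 < e)%N by rewrite expn_gt0.
exists (H ^ (2 * e).+1 * (M * 2))%N, (H ^ (M + 3 * e).+1)%N; split.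
  by rewrite !muln_gt0 expn_gt0 H0 M0.
move=> n leNn.
have n0 : (0 < n)%N by apply: leq_trans leNn; rewrite expn_gt0 H0.
have /andP[len ltn_] := trunc_log_bounds H1 n0.
have let0 : ((M + 3 * e).+1 <= trunc_log H n)%N by apply: trunc_log_max.
set t0 := trunc_log H n in len ltn_ let0.
(* t is the largest index owned by p with t < t0: the block of n itself may
   be incomplete. *)
pose l := ((t0 - 1 - e) %/ (2 * e))%N; pose t := (e * (1 + 2 * l))%N.
have [t_le t_gt] : (t.+1 <= t0)%N /\ (t0 <= t + 2 * e)%N.
  have := divn_eq (t0 - 1 - e) (2 * e); have := @ltn_pmod (t0 - 1 - e) (2 * e).
  rewrite -/l /t; nia.
have logt : logn 2 t = p.+1.
  by rewrite lognM // pfactorK // logn_coprime ?addn0 // coprime2n oddD oddM.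
have leMt : (M <= H ^ t)%N.
  by apply: (@leq_trans t); [lia | rewrite ltnW // ltn_expl].
pose c := (H ^ t %/ M)%N.
have c0 : (0 < c)%N by rewrite divn_gt0.
have cM : (c * M <= H ^ t)%N by apply: leq_trunc_div.
have Mc : (H ^ t < M * c.+1)%N by rewrite mulnC ltn_ceil.
(* The multiples of M in ]H^t, 2 H^t], an interval inside the block as H > 2. *)
have cE : (c <= \sum_(0 <= i < n.+1 | i \in block_set H M p) 1)%N.
  have := @card_le_count (block_set H M p) n.+1 [seq M * j | j <- iota c.+1 c]%N.
  rewrite size_map size_iota; apply.
    by rewrite map_inj_uniq ?iota_uniq // => i j /eqP; rewrite eqn_pmul2l // => /eqP.
  move=> i /mapP[j]; rewrite mem_iota => /andP[cj jc] ->.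
  have ge_ : (H ^ t <= M * j)%N by apply: leq_trans (ltnW Mc) _; rewrite leq_mul2l cj orbT.
  have Ht0 : (0 < H ^ t)%N by rewrite expn_gt0 H0.
  have lt_ : (M * j < H ^ t.+1)%N by rewrite expnS; nia.
  split; last by split; [exact: dvdn_mulr | rewrite (@trunc_log_eq H t)// ?ge_ ?lt_].
  by rewrite ltnS (leq_trans (ltnW lt_))// (leq_trans _ len)// leq_pexp2l.
apply: (@leq_trans (H ^ (2 * e).+1 * (M * 2) * c)); last by rewrite leq_mul2l cE orbT.
apply: leq_trans ltn_ _; apply: (@leq_trans (H ^ (2 * e).+1 * H ^ t)).
  by rewrite -expnD leq_pexp2l//; lia.
rewrite -mulnA leq_mul2l; apply/orP; right; apply: leq_trans (ltnW Mc) _; nia.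
Qed.

Lemma lower_density_gt0 (R : realType) (E : set nat) (Q N0 : nat) :
  (0 < Q)%N ->
  (forall n, (N0 <= n)%N -> (n.+1 <= Q * \sum_(0 <= i < n.+1 | i \in E) 1)%N) ->
  (0 < lower_density R E)%E.
Proof.
move=> Q0 HE; rewrite /lower_density limn_einf_lim.
apply: (@lt_le_trans _ _ ((Q%:R^-1 : R)%:E)).
  by rewrite lte_fin invr_gt0 ltr0n.
apply: (@le_trans _ _ (einfs (fun n : nat =>
    ((\sum_(0 <= i < n.+1 | i \in E) 1)%N%:R / n.+1%:R : R)%:E) N0)).
  apply: le_ereal_inf_tmp => _ [n /= N0n <-]; rewrite lee_fin.
  rewrite ler_pdivlMr ?ltr0n // mulrC ler_pdivrMr ?ltr0n // -natrM ler_nat.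
  by rewrite mulnC HE.
have /cvg_lim -> // := @cvg_einfs_sup R (fun n : nat =>
    ((\sum_(0 <= i < n.+1 | i \in E) 1)%N%:R / n.+1%:R : R)%:E).
by apply: ereal_sup_ubound; exists N0.
Qed.

(** * Geometric estimates *)

Lemma geometric_small (R : realType) (rho C d : R) : 0 < rho -> rho < 1 -> 0 <= C ->
  0 < d -> exists M, forall n, (M <= n)%N -> C * rho ^+ n <= d.
Proof.
move=> r0 r1 C0 d0.
have /cvgrPdist_le /(_ d d0) [M _ HM] : (fun n => C * rho ^+ n) @ \oo --> (0 : R).
  by apply: cvg_geometric; rewrite ger0_norm ?ltW.
exists M => n /HM /=; rewrite sub0r normrN; exact: le_trans (ler_norm _).
Qed.

Lemma sum_two_sided_geometric (R : realType) (rho : R) (m N : nat) :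
  0 <= rho -> rho < 1 ->
  \sum_(0 <= n < N) rho ^+ ((m - n) + (n - m)) <= 2 / (1 - rho).
Proof.
move=> r0 r1; rewrite ler_pdivlMr ?subr_gt0 // mulrC.
(* The two truncated differences let one induction cover both sides of m: the
   sum telescopes exactly for N >= m, and up to a factor rho for N < m. *)
suff : (1 - rho) * (\sum_(0 <= n < N) rho ^+ ((m - n) + (n - m)))
    + rho ^+ (N - m) <= 1 + rho ^+ (m - N).
  have := @exprn_ile1 _ (m - N) rho r0 (ltW r1).
  have := exprn_ge0 (N - m) r0; lra.
elim: N => [|N IH]; first by rewrite big_geq // mulr0 add0r subn0 lerDl exprn_ge0.
rewrite big_nat_recr //= mulrDr.
have [mN|Nm] := leqP m N.
  move: IH; rewrite (eqP mN) (eqP (leqW mN)) add0n subSn // exprS.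
  move: (\sum_(_ <= _ < _) _) (rho ^+ (N - m)) => u v; rewrite expr0 => IH; lra.
move: IH; rewrite (eqP (ltnW Nm)) (eqP Nm) -(subnSK Nm) addn0 !exprS expr0.
move: (\sum_(_ <= _ < _) _) (rho ^+ (m - N.+1)) (exprn_ge0 (m - N.+1) r0) => u z z0 IH.
have := mulr_ge0 z0 (sqr_ge0 (1 - rho)); lra.
Qed.

(** With i = min m n and j = max m n, the gap gives 4 (j - i) >= K i + j + (j - i),
    and rho^(K i) compensates B^i. The decay rate is written as a fourth power
    to leave, besides rho^(K i), a factor rho^j that beats any constant for j
    large and a factor rho^(j - i) that is summable uniformly in m. *)
Lemma gap_absorbs_ratio (R : realType) (rho B : R) (K m n : nat) :
  0 < rho -> rho <= 1 -> 0 <= B -> B * rho ^+ K <= 1 ->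
  ((K + 3) * minn m n <= maxn m n)%N ->
  B ^+ minn m n * (rho ^+ 4) ^+ ((m - n) + (n - m)) <=
    rho ^+ maxn m n * rho ^+ ((m - n) + (n - m)).
Proof.
move=> r0 r1 B0 BK; set i := minn m n; set j := maxn m n => ij.
have -> : ((m - n) + (n - m) = j - i)%N by rewrite /i /j; lia.
have le_ij : (i <= j)%N by rewrite /i /j; lia.
have [r er] : exists r, (4 * (j - i) = K * i + (j + (j - i)) + r)%N.
  by exists (4 * (j - i) - (K * i + (j + (j - i))))%N; lia.
rewrite -exprM er !exprD [in rho ^+ (K * i)]exprM.
have -> : B ^+ i * ((rho ^+ K) ^+ i * (rho ^+ j * rho ^+ (j - i)) * rho ^+ r) =
    (B * rho ^+ K) ^+ i * rho ^+ r * (rho ^+ j * rho ^+ (j - i)).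
  by rewrite exprMn 2!mulrA mulrAC.
have Bi1 : (B * rho ^+ K) ^+ i <= 1.
  by apply: exprn_ile1 => //; rewrite mulr_ge0 // exprn_ge0 ?ltW.
have rr1 : rho ^+ r <= 1 by apply: exprn_ile1 => //; exact: ltW.
rewrite ger_pMl ?mulr_gt0 ?exprn_gt0 // mulr_ile1 //.
- by rewrite exprn_ge0 // mulr_ge0 // exprn_ge0 ?ltW.
- by rewrite exprn_ge0 ?ltW.
Qed.

Lemma le_sum_of_ge0 (R : realType) (F : nat -> R) (i n : nat) :
  (forall j, 0 <= F j) -> (i <= n)%N -> F i <= \sum_(j < n.+1) F j.
Proof.
move=> F0 lin; rewrite (bigD1 (Ordinal (lin : (i < n.+1)%N))) //= lerDl.
exact: sumr_ge0.
Qed.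

Lemma fourth_root_lt1 (R : realType) (t : R) : 0 < t -> t < 1 ->
  exists rho, [/\ 0 < rho, rho < 1 & rho ^+ 4 = t].
Proof.
move=> t0 t1; exists (Num.sqrt (Num.sqrt t)); split.
- by rewrite !sqrtr_gt0.
- by rewrite -[ltRHS]sqrtr1 ltr_sqrt // -[ltRHS]sqrtr1 ltr_sqrt.
- by rewrite (exprM _ 2 2) !sqr_sqrtr ?sqrtr_ge0 ?ltW.
Qed.

(** * Seminorms over real or complex scalars *)

Lemma real_scalar_inj (R : realType) (k : scalar_kind) :
  injective (@real_scalar R k).
Proof. by case: k => //= x y []. Qed.

Lemma real_scalar1 (R : realType) (k : scalar_kind) : @real_scalar R k 1 = 1.
Proof. by case: k. Qed.

Lemma real_scalarM (R : realType) (k : scalar_kind) (a b : R) :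
  real_scalar k (a * b) = real_scalar k a * real_scalar k b.
Proof. by case: k => //=; rewrite rmorphM. Qed.

Lemma norm_real_scalar (R : realType) (k : scalar_kind) (a : R) :
  `|real_scalar k a| = real_scalar k `|a|.
Proof. by case: k => //=; rewrite normc_def /= expr0n addr0 sqrtr_sqr. Qed.

Section Seminorm.
Variables (R : realType) (k : scalar_kind) (X : lmodType (scalar_field R k)).
Variables (q : X -> R) (q_seminorm : seminorm q).

Lemma seminormZ (a : R) x : q (real_scalar k a *: x) = `|a| * q x.
Proof.
by apply: (@real_scalar_inj R k); rewrite q_seminorm.2 norm_real_scalar real_scalarM.
Qed.

Lemma seminorm0 : q 0 = 0.
Proof. by have := seminormZ 0 0; rewrite normr0 mul0r scaler0. Qed.

Lemma seminormN x : q (- x) = q x.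
Proof.
apply: (@real_scalar_inj R k); rewrite -scaleN1r q_seminorm.2.
by rewrite normrN1 mul1r.
Qed.

Lemma seminormB x y : q (x - y) = q (y - x).
Proof. by rewrite -seminormN opprB. Qed.

Lemma seminorm_ge0 x : 0 <= q x.
Proof.
have := q_seminorm.1 x (- x); rewrite subrr seminorm0 seminormN; lra.
Qed.

Lemma seminorm_sum (F : nat -> X) (P : pred nat) m n :
  q (\sum_(m <= i < n | P i) F i) <= \sum_(m <= i < n | P i) q (F i).
Proof.
elim/big_ind2 : _ => [|x a y b xa yb|//]; first by rewrite seminorm0.
by apply: le_trans (q_seminorm.1 _ _) _; rewrite lerD.
Qed.

End Seminorm.

(** * Convergence in a space topologized by seminorms *)

Definition defines_topology (R : realType) (k : scalar_kind)
    (X : topologicalLmodType (scalar_field R k)) (q : nat -> X -> R) :=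
  [/\ forall s, seminorm (q s), forall s x, q s x <= q s.+1 x
    & forall (x : X) (U : set X), nbhs x U <->
        exists s e, 0 < e /\ [set y | q s (y - x) < e] `<=` U].

Section Frechet.
Variables (R : realType) (k : scalar_kind).
Variables (X : topologicalLmodType (scalar_field R k)) (q : nat -> X -> R).
Hypothesis q_top : defines_topology q.

Let qS s : seminorm (q s). Proof. by case: q_top. Qed.

Lemma seminorm_mono s t x : (s <= t)%N -> q s x <= q t x.
Proof.
have [_ q_incr _] := q_top.
move=> /subnK <-; elim: (t - s)%N => // n; rewrite addSn => /le_trans; exact.
Qed.

Lemma cvg_seminorm (u : nat -> X) (l : X) : u @ \oo --> l <->
  forall s e, 0 < e -> exists N, forall n, (N <= n)%N -> q s (u n - l) < e.
Proof.
have [_ _ nbhsE] := q_top; split=> [ul s e e0|ul U /nbhsE[s [e [e0 eU]]]].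
  have /ul [N _ HN] : nbhs l [set y | q s (y - l) < e].
    by apply/nbhsE; exists s, e; split.
  by exists N => n /HN.
by have [N HN] := ul s e e0; exists N => // n /HN/eU.
Qed.

Lemma continuous_seminorm (f : X -> X) s e : continuous f -> f 0 = 0 -> 0 < e ->
  exists t d, 0 < d /\ forall x, q t x < d -> q s (f x) < e.
Proof.
have [_ _ nbhsE] := q_top; move=> fc f0 e0.
have /(fc 0)/nbhsE[t [d [d0 sub]]] : nbhs (f 0) [set y | q s y < e].
  by apply/nbhsE; exists s, e; split=> // y /=; rewrite f0 subr0.
by exists t, d; split=> // x xd; apply: sub; rewrite /= subr0.
Qed.

Lemma geometric_series_cvg (u : nat -> X) (rho : R) :
  (forall v : nat -> X, cauchy_sequence v -> exists l : X, v @ \oo --> l) ->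
  0 < rho -> rho < 1 ->
  (forall s, exists N, forall n, (N <= n)%N -> q s (u n) <= rho ^+ n) ->
  exists l : X, series u @ \oo --> l.
Proof.
have [_ _ nbhsE] := q_top; move=> complete r0 r1 small; apply: complete => U /nbhsE.
move=> [s [e [e0 eU]]]; have [N HN] := small s.
have r'0 : 0 < 1 - rho by rewrite subr_gt0.
have [M HM] := geometric_small r0 r1 (@ler0n R 2) (mulr_gt0 e0 (divr_gt0 r'0 (@ltr0n R 2))).
have key m n : (maxn N M <= n)%N -> (n <= m)%N ->
    q s (series u m - series u n) < e.
  rewrite geq_max => /andP[Nn Mn] nm; rewrite sub_series_geq //.
  apply: le_lt_trans (seminorm_sum (qS s) _ _ _ _) _.
  have tail : (1 - rho) * \sum_(n <= i < m) q s (u i) <= rho ^+ n.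
    suff : (1 - rho) * \sum_(n <= i < m) q s (u i) <= rho ^+ n - rho ^+ m.
      by have := exprn_gt0 m r0; lra.
    elim: m nm => [|m IH].
      by rewrite leqn0 => /eqP ->; rewrite big_geq // mulr0 subrr.
    rewrite leq_eqVlt => /orP[/eqP <-|]; first by rewrite big_geq // mulr0 subrr.
    rewrite ltnS => nm; rewrite big_nat_recr //= mulrDr exprS.
    have := HN m (leq_trans Nn nm); have := IH nm.
    move: (\sum_(_ <= _ < _) _) => z IHz qm.
    have := ler_wpM2l (ltW r'0) qm; lra.
  have := HM n Mn => rn; have := exprn_gt0 n r0 => rn0.
  by rewrite -(ltr_pM2l r'0); apply: le_lt_trans tail _; nra.
exists (`[maxn N M, +oo[, `[maxn N M, +oo[)%classic => /=.
  by split; exists (maxn N M) => // n /= ; rewrite in_itv /= andbT.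
move=> -[m n] [] /=; rewrite !in_itv /= !andbT => Nm Nn; apply: eU => /=; rewrite subr0.
have [nm|mn] := leqP n m; first exact: key.
by rewrite (seminormB (qS s)) key // ltnW.
Qed.

End Frechet.

(** * Orbits under multiples of the operator *)

Section Orbit.
Variables (R : realType) (k : scalar_kind) (X : lmodType (scalar_field R k)).
Variable T : {linear X -> X}.

Lemma iter_linear n : linear (iter n T).
Proof. by elim: n => [|n IH] a x y //=; rewrite IH linearP. Qed.

Lemma iter_scale_op l n x :
  iter n (scale_op l T) x = real_scalar k (l ^+ n) *: iter n T x.
Proof.
elim: n => [|n IH]; first by rewrite expr0 real_scalar1 scale1r.
by rewrite /= IH /scale_op linearZ /= scalerA -real_scalarM -exprS.
Qed.

Lemma iter_scale_op_linear l n : linear (iter n (scale_op l T)).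
Proof.
move=> a x y; rewrite !iter_scale_op iter_linear scalerDr !scalerA.
by rewrite mulrC.
Qed.

Lemma iterZ n a x : iter n T (a *: x) = a *: iter n T x.
Proof. by elim: n => //= n ->; rewrite linearZ. Qed.

(** The relation is required on the orbit of y alone: S may be neither linear
    nor a right inverse of T elsewhere. *)
Lemma iter_right_inverse (S : X -> X) y m n :
  (forall j, T (iter j.+1 S y) = iter j S y) ->
  iter m T (iter n S y) =
    if (m <= n)%N then iter (n - m) S y else iter (m - n) T y.
Proof.
move=> TS; elim: m => [|m IH] /=; first by rewrite subn0.
rewrite IH; have [mn|mn] := ltnP m n.
  by rewrite (ltnW mn) -(subnSK mn) TS.
have [nm|_] := leqP m n; last by rewrite subSn.
by have /eqP -> : n == m; rewrite ?eqn_leq ?mn ?nm // subSn ?subnn.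
Qed.

End Orbit.

(** Iterating, T cancels S: what remains is S^(n-m) y or T^(m-n) y, with the
    factor l^m / l'^n. Its exponents are common up to min m n, which gives the
    power of l / l' <= B; the rest of them combines with the decay of S^j y or
    of T^j y into powers of a / l' or l / b, both at most t. *)
Lemma interaction_le (R : realType) (k : scalar_kind)
    (X : lmodType (scalar_field R k)) (q : X -> R) (T : {linear X -> X})
    (S : X -> X) (y : X) (l l' a b C t B : R) (m n : nat) :
  seminorm q -> (forall j, T (iter j.+1 S y) = iter j S y) ->
  0 < l -> 0 < l' -> 0 < a -> 0 < b -> 0 <= C -> 0 < t ->
  l <= B * l' -> a <= t * l' -> l <= t * b ->
  (forall j, q (iter j S y) <= C * a ^+ j) ->
  (forall j, q (iter j T y) <= C / b ^+ j) ->
  q (iter m (scale_op l T) (real_scalar k (l' ^- n) *: iter n S y)) <=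
    C * B ^+ minn m n * t ^+ ((m - n) + (n - m)).
Proof.
move=> qS TS l0 l'0 a0 b0 C0 t0 lB at_ lt_ Sy Ty.
have B0 : 0 <= B by rewrite -(pmulr_lge0 _ l'0); apply: le_trans lB; exact: ltW.
have [l0' l'0' a0' b0' t0'] := And5 (ltW l0) (ltW l'0) (ltW a0) (ltW b0) (ltW t0).
rewrite iter_scale_op iterZ iter_right_inverse // !(seminormZ qS).
rewrite !ger0_norm ?invr_ge0 ?exprn_ge0 // mulrA.
have le_pow x z i : 0 <= x -> x <= z -> x ^+ i <= z ^+ i.
  by move=> x0 xz; rewrite lerXn2r // nnegrE // (le_trans x0).
have split_le c i j : 0 <= c -> c <= t ->
    C * (l / l') ^+ i * c ^+ j <= C * B ^+ i * t ^+ j.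
  move=> c0 ct; apply: ler_pM.
  - by rewrite mulr_ge0 // exprn_ge0 // divr_ge0.
  - exact: exprn_ge0.
  - by rewrite ler_wpM2l // le_pow ?divr_ge0 // ler_pdivrMr.
  - exact: le_pow.
have [mn|nm] := leqP m n.
- rewrite (eqP mn) add0n; apply: le_trans (split_le (a / l') _ _ _ _); last 2 first.
  + exact: divr_ge0.
  + by rewrite ler_pdivrMr.
  have -> : C * (l / l') ^+ m * (a / l') ^+ (n - m) =
      l ^+ m / l' ^+ n * (C * a ^+ (n - m)).
    rewrite -[in l' ^+ n](subnKC mn) exprD !expr_div_n invfM.
    by move: (l' ^- m) (l' ^- _) (a ^+ _) (l ^+ m) => ? ? ? ?; ring.
  by rewrite ler_wpM2l // divr_ge0 ?exprn_ge0.
- rewrite (eqP (ltnW nm)) addn0; apply: le_trans (split_le (l / b) _ _ _ _); last 2 first.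
  + exact: divr_ge0.
  + by rewrite ler_pdivrMr.
  have -> : C * (l / l') ^+ n * (l / b) ^+ (m - n) =
      l ^+ m / l' ^+ n * (C / b ^+ (m - n)).
    rewrite -[in l ^+ m](subnKC (ltnW nm)) exprD !expr_div_n.
    by move: (l' ^- n) (b ^- _) (l ^+ n) (l ^+ _) => ? ? ? ?; ring.
  by rewrite ler_wpM2l // divr_ge0 ?exprn_ge0.
Qed.

(** * The common orbit *)

(** The constants C (p, s) of the decay of the orbits of y_p in the seminorm
    q_s are not uniform. This is repaired by starting E_p late: every element of
    E_p is at least M p, and M p is such that rho^n, for n >= M p, is at most
    [delta p] even after multiplication by any C (p', s) with p', s <= p.
    The same M p is the spacing of E_p, which settles the interaction of p with
    itself. For the interaction of p with p', max m n is at least M p and M p',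
    and so C (p', p) is covered. *)
Lemma simultaneous_approximation (R : realType) (k : scalar_kind)
    (X : topologicalLmodType (scalar_field R k)) (q : nat -> X -> R)
    (T : {linear X -> X}) (S : X -> X) (y : nat -> X) (lam : nat -> R)
    (a b rho B : R) (K : nat) :
  defines_topology q ->
  (forall v : nat -> X, cauchy_sequence v -> exists l : X, v @ \oo --> l) ->
  continuous T ->
  (forall p j, T (iter j.+1 S (y p)) = iter j S (y p)) ->
  (forall p s, exists C : R, 0 <= C /\ forall j,
     q s (iter j S (y p)) <= C * a ^+ j /\ q s (iter j T (y p)) <= C / b ^+ j) ->
  0 < a -> 0 < b -> 0 < rho -> rho < 1 ->
  (forall p, [/\ 0 < lam p, a <= rho ^+ 4 * lam p & lam p <= rho ^+ 4 * b]) ->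
  (forall p p', lam p <= B * lam p') -> B * rho ^+ K <= 1 ->
  exists (x : X) (M : nat -> nat), forall p, (0 < M p)%N /\
    forall m, block_set (K + 3) (M p) p m ->
      q p (iter m (scale_op (lam p) T) x - y p) < p.+1%:R^-1.
Proof.
move=> q_top complete T_cont TS bounds a0 b0 r0 r1 lamP lamB BK.
have qS s : seminorm (q s) by case: q_top.
have lam0 p : 0 < lam p by case: (lamP p).
have B0 : 0 <= B.
  by rewrite -(pmulr_lge0 _ (lam0 0%N)); apply: le_trans (lamB 0%N 0%N); exact: ltW.
have r40 : 0 < rho ^+ 4 by exact: exprn_gt0.
have r'0 : 0 < 1 - rho by rewrite subr_gt0.
have [C HC] := choice (fun ps => bounds ps.1 ps.2).
have C0 p s : 0 <= C (p, s) by case: (HC (p, s)).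
have CS p s j : q s (iter j S (y p)) <= C (p, s) * a ^+ j.
  by case: (HC (p, s)) => _ /(_ j)[].
have CT p s j : q s (iter j T (y p)) <= C (p, s) / b ^+ j.
  by case: (HC (p, s)) => _ /(_ j)[].
(* The errors sum to at most delta p * 2 / (1 - rho) = 1 / (2 (p + 1)). *)
pose delta p := (1 - rho) / (4 * p.+1%:R).
have delta0 p : 0 < delta p by rewrite divr_gt0 // mulr_gt0 ?ltr0n.
have delta_le p p' : (p <= p')%N -> delta p' <= delta p.
  by move=> pp'; rewrite ler_pM2l // lef_pV2 ?posrE ?mulr_gt0 ?ltr0n // ler_pM2l ?ler_nat.
have delta1 p : delta p <= 1.
  rewrite ler_pdivrMr ?mulr_gt0 ?ltr0n // mul1r.
  by have : (1 : R) <= p.+1%:R; [rewrite ler1n | lra].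
have /choice[M HM] : forall r, exists M, (0 < M)%N /\
    forall n p s, (M <= n)%N -> (p <= r)%N -> (s <= r)%N ->
      C (p, s) * rho ^+ n <= delta r.
  move=> r.
  have sumC0 : 0 <= \sum_(i < r.+1) \sum_(j < r.+1) C (nat_of_ord i, nat_of_ord j).
    by apply: sumr_ge0 => i _; apply: sumr_ge0.
  have [M HM] := geometric_small r0 r1 sumC0 (delta0 r).
  exists M.+1; split=> // n p s /ltnW Mn pr sr; apply: le_trans (HM n Mn).
  rewrite ler_pM2r ?exprn_gt0 //.
  apply: le_trans (@le_sum_of_ge0 _ (fun j => C (p, j)) _ _ (C0 p) sr) _.
  apply: (@le_sum_of_ge0 _ (fun i => \sum_(j < r.+1) C (i, nat_of_ord j)) _ _ _ pr).
  by move=> j; apply: sumr_ge0.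
have M0 p : (0 < M p)%N by case: (HM p).
have CM n p s : (M p <= n)%N -> (M s <= n)%N ->
    C (p, s) * rho ^+ n <= delta (maxn p s).
  move=> Mp Ms; case: (HM (maxn p s)) => _; apply.
  - by rewrite /maxn; case: ifP.
  - exact: leq_maxl.
  - exact: leq_maxr.
pose E p := block_set (K + 3) (M p) p.
pose idx n := (logn 2 (trunc_log (K + 3) n)).-1.
have E_idx p n : E p n -> idx n = p by move=> [_]; rewrite /idx => ->.
pose u n := if `[< E (idx n) n >]
  then real_scalar k (lam (idx n) ^- n) *: iter n S (y (idx n)) else 0.
have uE p n : E p n -> u n = real_scalar k (lam p ^- n) *: iter n S (y p).
  by move=> En; rewrite /u (E_idx _ _ En) asboolT.
have uP n : u n = 0 \/ exists p, E p n.
  by rewrite /u; case: asboolP => [En|_]; [right; exists (idx n) | left].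
have interact p p' m n s :
    q s (iter m (scale_op (lam p) T) (real_scalar k (lam p' ^- n) *: iter n S (y p')))
    <= C (p', s) * B ^+ minn m n * (rho ^+ 4) ^+ ((m - n) + (n - m)).
  have [_ _ lp] := lamP p; have [_ lp' _] := lamP p'.
  by apply: (@interaction_le _ _ _ _ _ _ _ _ _ a b).
have interact_same p m n s :
    q s (iter m (scale_op (lam p) T) (real_scalar k (lam p ^- n) *: iter n S (y p)))
    <= C (p, s) * (rho ^+ 4) ^+ ((m - n) + (n - m)).
  have [_ lp lp'] := lamP p.
  have := @interaction_le _ _ _ _ T S (y p) (lam p) (lam p) a b (C (p, s)) (rho ^+ 4) 1 m n (qS s).
  by rewrite expr1n mulr1 mul1r; apply.
have rho_le i j : (i <= j)%N -> rho ^+ j <= rho ^+ i.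
  by move=> ij; rewrite ler_wiXn2l ?(ltW r0) ?(ltW r1).
have off_diag p m n : E p m -> n != m ->
    q p (iter m (scale_op (lam p) T) (u n)) <= delta p * rho ^+ ((m - n) + (n - m)).
  move=> Em nm; have [->|[p' En]] := uP n.
    rewrite iter_scale_op (_ : iter m T 0 = 0) ?scaler0 ?(seminorm0 (qS p)).
      by rewrite mulr_ge0 ?exprn_ge0 ?ltW.
    by elim: (m) => //= i ->; rewrite linear0.
  rewrite (uE _ _ En); have [pp'|pp'] := eqVneq p p'.
    move: En; rewrite -pp' => En; apply: le_trans (interact_same _ _ _ _) _.
    have Md : (M p <= (m - n) + (n - m))%N.
      by apply: block_set_dist Em En _; rewrite eq_sym.
    have := CM _ p p Md Md; rewrite maxnn => Cd.
    apply: le_trans (_ : C (p, p) * rho ^+ ((m - n) + (n - m)) *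
                         rho ^+ ((m - n) + (n - m)) <= _).
      rewrite -mulrA -exprM -exprD ler_wpM2l // rho_le //; lia.
    by rewrite ler_pM2r ?exprn_gt0.
  apply: le_trans (interact _ _ _ _ _) _.
  have gap : ((K + 3) * minn m n <= maxn m n)%N.
    have H1 : (1 < K + 3)%N by lia.
    case: (ltngtP m n) nm => // lt_mn _.
    - exact: (block_set_gap H1 Em En pp' lt_mn).
    - by apply: (block_set_gap H1 En Em _ lt_mn); rewrite eq_sym.
  rewrite -mulrA; apply: le_trans
    (ler_wpM2l (C0 p' p) (gap_absorbs_ratio r0 (ltW r1) B0 BK gap)) _.
  rewrite mulrA ler_pM2r ?exprn_gt0 //.
  apply: le_trans (CM _ _ _ _ _) (delta_le _ _ (leq_maxr _ _)).
  - by rewrite (leq_trans (block_set_ge En)) // leq_maxr.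
  - by rewrite (leq_trans (block_set_ge Em)) // leq_maxl.
(* The terms of the series are the interactions with m = 0. *)
have u_small s : exists N, forall n, (N <= n)%N -> q s (u n) <= rho ^+ n.
  exists (M s) => n Mn; have [->|[p En]] := uP n.
    by rewrite (seminorm0 (qS s)) exprn_ge0 ?ltW.
  rewrite (uE _ _ En); apply: le_trans (interact_same p 0%N n s) _.
  rewrite sub0n add0n subn0; apply: le_trans (_ : C (p, s) * rho ^+ n * rho ^+ n <= _).
    by rewrite -mulrA -exprM -exprD ler_wpM2l // rho_le //; lia.
  rewrite ger_pMl ?exprn_gt0 //; apply: le_trans (delta1 (maxn p s)).
  exact: CM (block_set_ge En) Mn.
have [x ux] := geometric_series_cvg q_top complete r0 r1 u_small.
exists x, M => p; split=> // m Em.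
pose f : {linear X -> X} := HB.pack_for {linear X -> X} (iter m (scale_op (lam p) T))
  (GRing.isLinear.Build _ _ _ _ (iter m (scale_op (lam p) T))
     (iter_scale_op_linear T (lam p) m)).
have e0 : 0 < (p.+1%:R^-1 : R) / 2 by rewrite divr_gt0 ?invr_gt0 ?ltr0n.
have lm0 : 0 < lam p ^+ m by rewrite exprn_gt0.
have iterT_cont : continuous (iter m T).
  elim: (m) => [|i IH] z; first exact: cvg_id.
  by apply: continuous_comp; [exact: IH | exact: T_cont].
have iterT0 : iter m T 0 = 0 by elim: (m) => //= i ->; rewrite linear0.
have [t [d [d0 fd]]] :=
  @continuous_seminorm _ _ _ _ q_top _ p _ iterT_cont iterT0 (divr_gt0 e0 lm0).
have [N HN] := (cvg_seminorm q_top _ _).1 ux t d d0.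
pose n := maxn N m.+1; have mn : (m < n)%N by rewrite leq_max leqnn orbT.
have near_x : q p (f x - f (series u n)) < p.+1%:R^-1 / 2.
  rewrite (seminormB (qS p)) -linearB /= iter_scale_op (seminormZ (qS p)).
  rewrite gtr0_norm // mulrC -ltr_pdivlMr //; apply: fd.
  by apply: HN; rewrite leq_maxl.
have f_um : f (u m) = y p.
  rewrite (uE _ _ Em) /= iter_scale_op iterZ iter_right_inverse //.
  by rewrite leqnn subnn scalerA -real_scalarM mulfV ?gt_eqF // real_scalar1 scale1r.
have near_y : q p (f (series u n) - y p) <= p.+1%:R^-1 / 2.
  have -> : f (series u n) = \sum_(0 <= i < n) f (u i) by rewrite -linear_sum.
  rewrite (bigD1_seq m) ?iota_uniq ?mem_index_iota //.
  rewrite f_um addrC addKr; apply: le_trans (seminorm_sum (qS p) _ _ _ _) _.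
  apply: (@le_trans _ _ (\sum_(0 <= i < n) delta p * rho ^+ ((m - i) + (i - m)))).
    rewrite big_mkcond; apply: ler_sum => i _; case: eqVneq => [_|im].
      by rewrite mulr_ge0 ?exprn_ge0 ?ltW.
    exact: off_diag.
  rewrite -big_distrr /=.
  apply: le_trans (ler_wpM2l (ltW (delta0 p)) (sum_two_sided_geometric m n (ltW r0) r1)) _.
  have p0 : p.+1%:R != 0 :> R by rewrite pnatr_eq0.
  have rn0 : 1 - rho != 0 by rewrite gt_eqF.
  rewrite /delta; move: (p.+1%:R : R) (1 - rho) p0 rn0 => z w z0 w0.
  by rewrite le_eqVlt; apply/orP; left; apply/eqP; field; rewrite z0 w0.
(* Continuity of f replaces x by a partial sum, whose error terms are then
   finite in number. *)
rewrite -[iter m _ x]/(f x) (_ : f x - y p = (f x - f (series u n)) + (f (series u n) - y p)).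
  by apply: le_lt_trans ((qS p).1 _ _) _; rewrite [ltRHS]splitr ltr_leD.
by rewrite addrA subrK.
Qed.

(** * Growth rates from the convergence of the series *)

Lemma unconditionally_convergent_cvg (K : numDomainType)
    (X : topologicalLmodType K) (u : nat -> X) :
  unconditionally_convergent u -> exists l : X, series u @ \oo --> l.
Proof. by move=> /(_ id); apply; exists id. Qed.

(** From some index on, a term is the difference of two partial sums within 1
    of the limit. *)
Lemma cvg_series_bounded (R : realType) (k : scalar_kind)
    (X : topologicalLmodType (scalar_field R k)) (q : nat -> X -> R)
    (u : nat -> X) (l : X) (s : nat) :
  defines_topology q -> series u @ \oo --> l ->
  exists C : R, 0 <= C /\ forall n, q s (u n) <= C.
Proof.
move=> q_top ul; have qS : seminorm (q s) by case: q_top.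
have [N HN] := (cvg_seminorm q_top _ _).1 ul s 1 ltr01.
have sum0 : 0 <= \sum_(j < N.+1) q s (u j).
  by apply: sumr_ge0 => j _; exact: seminorm_ge0.
exists (2 + \sum_(j < N.+1) q s (u j)); split; first lra.
move=> n; have [nN|Nn] := leqP n N.
  have := @le_sum_of_ge0 _ (fun j => q s (u j)) n N (fun j => seminorm_ge0 qS _) nN.
  lra.
have -> : u n = (series u n.+1 - l) + (l - series u n).
  by rewrite addrA subrK /series /= big_nat_recr //= [X in _ = X]addrC addKr.
have := qS.1 (series u n.+1 - l) (l - series u n).
rewrite [q s (l - _)](seminormB qS).
have := HN n.+1 (leqW (ltnW Nn)); have := HN n (ltnW Nn).
move: (q s _) (q s _) (q s _) (\sum_(_ < _) _) sum0 => x y z w; lra.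
Qed.

Lemma growth_below_a_T (R : realType) (k : scalar_kind)
    (X : topologicalLmodType (scalar_field R k)) (q : nat -> X -> R)
    (X0 : set X) (S : X -> X) (al : R) :
  defines_topology q -> (a_T X0 S < al%:E)%E ->
  exists a : R, [/\ 0 < a, a < al & forall x s, X0 x ->
    exists C, 0 <= C /\ forall j, q s (iter j S x) <= C * a ^+ j].
Proof.
move=> q_top /ereal_inf_lt[_ [a [a0 conv] <-]]; rewrite lte_fin => a_al.
exists a; split=> // x s X0x.
have [l ul] := unconditionally_convergent_cvg (conv x X0x).
have [C [C0 HC]] := cvg_series_bounded s q_top ul.
exists C; split=> // j; have qS : seminorm (q s) by case: q_top.
have := HC j; rewrite (seminormZ qS) ger0_norm ?invr_ge0 ?exprn_ge0 ?(ltW a0) //.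
by rewrite mulrC ler_pdivrMr // exprn_gt0.
Qed.

Lemma growth_above_b_T (R : realType) (k : scalar_kind)
    (X : topologicalLmodType (scalar_field R k)) (q : nat -> X -> R)
    (X0 : set X) (T : {linear X -> X}) (be : R) :
  defines_topology q -> (be%:E < b_T X0 T)%E ->
  exists b : R, [/\ 0 < b, be < b & forall x s, X0 x ->
    exists C, 0 <= C /\ forall j, q s (iter j T x) <= C / b ^+ j].
Proof.
move=> q_top /ereal_sup_gt[_ [b [b0 conv] <-]]; rewrite lte_fin => be_b.
exists b; split=> // x s X0x.
have [l ul] := unconditionally_convergent_cvg (conv x X0x).
have [C [C0 HC]] := cvg_series_bounded s q_top ul.
exists C; split=> // j; have qS : seminorm (q s) by case: q_top.
have := HC j; rewrite iter_scale_op (seminormZ qS) ger0_norm ?exprn_ge0 ?(ltW b0) //.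
by rewrite ler_pdivlMr ?exprn_gt0 // mulrC.
Qed.

(** * Existence of a common frequently hypercyclic vector *)

Lemma injective_unbounded (g : nat -> nat) (N : nat) : injective g ->
  exists k, (N <= g k)%N.
Proof.
move=> ginj; apply/not_existsP => small.
have := @uniq_leq_size _ (map g (iota 0 N.+1)) (iota 0 N).
rewrite map_inj_uniq // iota_uniq size_map !size_iota ltnn => /(_ isT) H.
suff : false by []; apply: H => _ /mapP[i _ ->]; rewrite mem_iota /= add0n.
by rewrite ltnNge; apply/negP/small.
Qed.

Lemma countable_enumeration (A : Type) (D : set A) : countable D -> D !=set0 ->
  exists f : nat -> A, (forall n, D (f n)) /\ forall x, D x -> exists n, f n = x.
Proof.
move=> /countable_injP[g ginj] [x0 Dx0].
have /choice[f Hf] : forall n, exists x, D x /\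
    ((exists2 z, D z & g z = n) -> g x = n).
  move=> n; have [[z Dz gz]|no] := pselect (exists2 z, D z & g z = n).
    by exists z.
  by exists x0; split.
exists f; split=> [n|x Dx]; first by case: (Hf n).
have [Df gf] := Hf (g x); exists (g x).
by apply: ginj; rewrite ?inE //; apply: gf; exists x.
Qed.

Lemma dense_approx (R : realType) (k : scalar_kind)
    (X : topologicalLmodType (scalar_field R k)) (q : nat -> X -> R)
    (A : set X) (x : X) (s : nat) (e : R) :
  defines_topology q -> dense A -> 0 < e -> exists2 y, A y & q s (y - x) < e.
Proof.
move=> [_ _ nbhsE] denseA e0.
have xV : nbhs x [set y | q s (y - x) < e] by apply/nbhsE; exists s, e; split.
have [y [Vy Ay]] := denseA _ (ex_intro _ x (nbhs_singleton (nbhs_interior xV)))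
  (@open_interior _ _).
by exists y => //; exact: (interior_subset Vy).
Qed.

Theorem theorem2p9 (R : realType) (k : scalar_kind)
    (X : topologicalLmodType (scalar_field R k))
    (X_frechet : frechet_space X) (X_separable : separable X)
    (T : {linear X -> X}) (T_continuous : continuous T)
    (X0 : set X) (X0_dense : dense X0) (S : {fun X0 >-> X0})
    (TS : forall x, X0 x -> T (S x) = x)
    (L : set R) (L_countable : countable L) (L_nonempty : L !=set0)
    (L_interval : L `<=` [set l : R | (a_T X0 S < l%:E < b_T X0 T)%E])
    (L_relcompact :
       relatively_compact_in [set l : R | (a_T X0 S < l%:E < b_T X0 T)%E] L) :
  \bigcap_(l in L) FHC R (scale_op l T) !=set0.
Proof.
have [[q [qS q_incr _ nbhsE]] complete] := X_frechet.
have q_top : defines_topology q by [].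
have [D D_countable D_dense] := X_separable.
have [fD [fDD fD_onto]] : exists f : nat -> X, (forall n, D (f n)) /\
    forall x, D x -> exists n, f n = x.
  apply: countable_enumeration => //.
  by have [x [_ Dx]] := D_dense setT (ex_intro _ 0 I) openT; exists x.
have [fL [fLL fL_onto]] := countable_enumeration L_countable L_nonempty.
have [L_compact L_in] := L_relcompact.
have clL0 : closure L !=set0.
  by case: L_nonempty => l Ll; exists l; exact: subset_closure.
have id_cont : {within closure L, continuous (id : R -> R)}.
  by apply: continuous_subspaceT => z; exact: cvg_id.
have [al /set_mem al_clL al_min] := compact_EVT_min clL0 L_compact id_cont.
have [be /set_mem be_clL be_max] := compact_EVT_max clL0 L_compact id_cont.
have al_le n : al <= fL n by apply/al_min/mem_set/subset_closure/fLL.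
have be_ge n : fL n <= be by apply/be_max/mem_set/subset_closure/fLL.
have /andP[a_al _] := L_in _ al_clL; have /andP[_ be_b] := L_in _ be_clL.
have [a [a0 a_lt_al decayS]] := growth_below_a_T q_top a_al.
have [b [b0 be_lt_b decayT]] := growth_above_b_T q_top be_b.
have al0 : 0 < al := lt_trans a0 a_lt_al.
have fL0 n : 0 < fL n := lt_le_trans al0 (al_le n).
have be0 : 0 < be := lt_le_trans (fL0 0%N) (be_ge 0%N).
pose t := Num.max (a / al) (be / b).
have t0 : 0 < t by rewrite lt_max divr_gt0.
have t1 : t < 1 by rewrite gt_max !ltr_pdivrMr // !mul1r a_lt_al be_lt_b.
have [rho [r0 r1 rt]] := fourth_root_lt1 t0 t1.
have a_le n : a <= rho ^+ 4 * fL n.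
  apply: le_trans (_ : t * al <= _); last by rewrite rt ler_pM2l.
  by rewrite -ler_pdivrMr // le_max lexx.
have fL_le n : fL n <= rho ^+ 4 * b.
  by apply: le_trans (be_ge n) _; rewrite rt -ler_pdivrMr // le_max lexx orbT.
have B0 : 0 <= be / al by rewrite divr_ge0 ?ltW.
have fLB m n : fL m <= be / al * fL n.
  apply: le_trans (be_ge m) _; rewrite mulrAC ler_pdivlMr //.
  by rewrite ler_pM2l.
have [K HK] := geometric_small r0 r1 B0 ltr01.
pose ijk (p : nat) : nat * nat * nat := odflt (0, 0, 0)%N (unpickle p).
pose lam p := fL (ijk p).1.1; pose d p := fD (ijk p).1.2.
have /choice[y Hy] : forall p, exists y, X0 y /\ q p (y - d p) < p.+1%:R^-1.
  move=> p; have p0 : (0 : R) < p.+1%:R^-1 by rewrite invr_gt0 ltr0n.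
  by have [y X0y yd] := dense_approx (d p) p q_top X0_dense p0; exists y.
have X0_iter p j : X0 (iter j S (y p)).
  by elim: j => [|j IH]; [case: (Hy p) | exact: (@funS _ _ X0 X0 S)].
have [x [M xM]] : exists (x : X) (M : nat -> nat), forall p, (0 < M p)%N /\
    forall m, block_set (K + 3) (M p) p m ->
      q p (iter m (scale_op (lam p) T) x - y p) < p.+1%:R^-1.
  apply: (@simultaneous_approximation R k X q T S y lam a b rho (be / al) K) => //.
  - by move=> p j /=; rewrite TS.
  - move=> p s; have [X0y _] := Hy p.
    have [C [C0 HC]] := decayS _ s X0y; have [C' [C'0 HC']] := decayT _ s X0y.
    exists (C + C'); split=> [|j]; first exact: addr_ge0.
    split; [apply: le_trans (HC j) _ | apply: le_trans (HC' j) _].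
      by rewrite ler_pM2r ?exprn_gt0 // lerDl.
    by rewrite ler_pM2r ?invr_gt0 ?exprn_gt0 // lerDr.
  - by move=> p; split; [exact: fL0 | exact: a_le | exact: fL_le].
  - by move=> p p'; exact: fLB.
  - exact: HK.
exists x => l Ll U U_open U_nonempty.
have [z [Uz Dz]] := D_dense U U_nonempty U_open.
have [i fLi] := fL_onto l Ll; have [j fDj] := fD_onto z Dz.
have [s [e [e0 eU]]] := (nbhsE z U).1 (open_nbhs_nbhs (conj U_open Uz)).
(* The third component of the code makes every pair (l, z) recur at arbitrarily
   large indices p, for which the seminorm q_p is fine enough and 2 / (p + 1)
   small enough. *)
have [c pc] := @injective_unbounded (fun c => pickle (i, j, c))
  (maxn s (Num.bound (2 / e)))
  (fun c c' ecc => congr1 snd (pcan_inj (@pickleK _) ecc)).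
move: pc; set p := pickle _; rewrite geq_max => /andP[sp ep].
have ijkp : ijk p = (i, j, c) by rewrite /ijk pickleK.
have lamp : lam p = l by rewrite /lam ijkp.
have dp : d p = z by rewrite /d ijkp.
have pe : 2 / p.+1%:R < e.
  rewrite ltr_pdivrMr ?ltr0n // mulrC -ltr_pdivrMr //.
  apply: lt_le_trans (archi_boundP (divr_ge0 (ler0n R 2) (ltW e0))) _.
  by rewrite ler_nat ltnW.
have [Mp Hp] := xM p.
have [Q [N0 [Q0 HQ]]] := @block_set_count (K + 3) (M p) p (leq_addl K 3) Mp.
apply: (@lower_density_gt0 R _ Q N0) => // n /HQ/leq_trans; apply.
rewrite leq_pmul2l // count_mono // => m Em /=; apply: eU => /=.
have := Hp m Em; have [_ ] := Hy p; rewrite lamp dp => yz xy.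
apply: le_lt_trans (seminorm_mono q_top _ sp) _.
rewrite (_ : _ - z = (iter m (scale_op l T) x - y p) + (y p - z)); last first.
  by rewrite addrA subrK.
apply: le_lt_trans ((qS p).1 _ _) _; apply: lt_trans pe.
by rewrite mulrC mulr_natr mulr2n ltrD.
Qed.
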